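(* Let $X$ be a normed space and let $F:X\rightrightarrows X$ be a set-valued mapping. Let $L\subset S_X$ and $U\subset X$ be nonempty sets and let $\tau>0$. Then the following statements are equivalent: (i) $F$ is directionally orbitally regular on $U$ w.r.t. $L$ with constant $\tau$; (ii) $F^{-1}$ is directionally orbitally Aubin continuous on $U$ w.r.t. $L$ with constant $\tau$; (iii) $F$ is directionally orbitally open on $U$ w.r.t. $L$ with constant $\tau^{-1}$.
   Context: $S_X$ is the unit sphere of $X$, $\mathbf{B}(x,r)$ the open ball, $\operatorname{cone}L=\{tu:t\ge0,\ u\in L\}$, $\mathbf{d}(x,A)=\inf_{a\in A}\|x-a\|$ with $\mathbf{d}(x,\emptyset)=+\infty$, and $F^{-1}(y)=\{x:y\in F(x)\}$. The directional minimal time function is $T_L(x,A):=\inf\{t\ge 0:(x+tL)\cap A\ne\emptyset\}$ with $\inf\emptyset=+\infty$, and $T_L(x,u):=T_L(x,\{u\})$. For a set-valued mapping $H:X\rightrightarrows X$ and a constant $\kappa>0$: - $H$ is directionally orbitally regular on $U$ w.r.t. $L$ with constant $\kappa$ if for every $x\in U$: $\kappa T_L(x,H(x))<\mathbf{d}(x,X\setminus U)\Rightarrow T_L(x,H^{-1}(x))\le\kappa T_L(x,H(x))$. - $H$ is directionally orbitally Aubin continuous on $U$ w.r.t. $L$ with constant $\kappa$ if for every $x\in U$ and $u\in X$: $x\in H(u)$ and $\kappa T_L(x,u)<\mathbf{d}(x,X\setminus U)$ imply $T_L(x,H(x))\le\kappa T_L(x,u)$. - $H$ is directionally orbitally open on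 $U$ w.r.t. $L$ with constant $\kappa$ if for every $x\in U$ and every $t$: $T_L(x,H(x))<\kappa t$ and $t<\mathbf{d}(x,X\setminus U)$ imply $x\in H\bigl(\mathbf{B}(x,t)\cap[x+\operatorname{cone}L]\bigr)$. *)

(* Defs.v *)
From HB Require Import structures.
From mathcomp Require Import all_boot all_order all_algebra.
From mathcomp Require Import all_classical all_reals all_analysis.
Import Order.TTheory GRing.Theory Num.Theory.
Import numFieldNormedType.Exports.

Set Implicit Arguments.
Unset Strict Implicit.
Unset Printing Implicit Defensive.

Local Open Scope classical_set_scope.
Local Open Scope ring_scope.

(* A set-valued mapping X => Y is a function H : X -> set Y. *)

Definition inverse_map (X Y : Type) (H : X -> set Y) : Y -> set X :=
  fun y => [set x | H x y].

Definition image_map (X Y : Type) (H : X -> set Y) (A : set X) : set Y :=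
  \bigcup_(x in A) H x.

Section Directional.
Context {R : realType} {X : normedModType R}.
Implicit Types (x u : X) (A L U : set X) (H : X -> set X) (kappa : R).

Definition unit_sphere : set X := [set x | `|x| = 1].

Definition cone L : set X :=
  [set v | exists t : R, exists u, [/\ 0 <= t, L u & v = t *: u]].

(* Both infima are taken in \bar R, where ereal_inf set0 = +oo. *)
Definition dist_to x A : \bar R := ereal_inf [set `|x - a|%:E | a in A].

Definition dir_min_time L x A : \bar R :=
  ereal_inf [set t%:E | t in
    [set t : R | 0 <= t /\ [set x + t *: l | l in L] `&` A !=set0]].

Definition dir_orbitally_regular H U L kappa : Prop :=
  forall x, U x ->
    (kappa%:E * dir_min_time L x (H x) < dist_to x (~` U))%E ->
    (dir_min_time L x (inverse_map H x)
       <= kappa%:E * dir_min_time L x (H x))%E.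

Definition dir_orbitally_Aubin H U L kappa : Prop :=
  forall x u, U x -> H u x ->
    (kappa%:E * dir_min_time L x [set u] < dist_to x (~` U))%E ->
    (dir_min_time L x (H x) <= kappa%:E * dir_min_time L x [set u])%E.

Definition dir_orbitally_open H U L kappa : Prop :=
  forall x (t : R), U x ->
    (dir_min_time L x (H x) < (kappa * t)%:E)%E ->
    (t%:E < dist_to x (~` U))%E ->
    image_map H (ball x t `&` [set x + v | v in cone L]) x.

End Directional.

(* Main.v *)
(* The cycle (i) => (ii) => (iii) => (i).  An element u of F(x) gives
   T_L(x, F(x)) <= T_L(x, u), hence (i) => (ii).  For (ii) => (iii), a real
   number strictly above the infimum T_L(x, A) is witnessed by a point of A of
   the form x + s l, and |s l| = s since L lies in the unit sphere.  For
   (iii) => (i), openness applies to every t strictly between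
   tau T_L(x, F(x)) and d(x, X \ U), and t then decreases to the former. *)
Require Import Defs.
From mathcomp Require Import all_boot all_order all_algebra.
From mathcomp Require Import all_classical all_reals all_analysis.
Import Order.TTheory GRing.Theory Num.Theory.
Import numFieldNormedType.Exports.
Local Open Scope classical_set_scope.
Local Open Scope ring_scope.

(** Openness takes a real radius, whereas the upper bound here may be [+oo], as is the distance to
    the complement of [U] when [U] is all of [X]. *)
Lemma lte_fin_between (R : realFieldType) (r : R) (e : \bar R) :
  (r%:E < e)%E -> exists2 t : R, r < t & (t%:E < e)%E.
Proof.
case: e => [s| |//]; last by exists (r + 1); rewrite ?ltrDl // ltry.
rewrite lte_fin => rs; exists ((r + s) / 2); first by rewrite midf_lt.
by rewrite lte_fin midf_lt.
Qed.

Section DirMinTime.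
Context {R : realType} {X : normedModType R}.
Implicit Types (x l : X) (A B L : set X) (s t : R).

Lemma dir_min_time_ge0 L x A : (0 <= dir_min_time L x A)%E.
Proof. by apply: le_ereal_inf_tmp => _ [s [s0 _] <-]; rewrite lee_fin. Qed.

Lemma dir_min_time_le L x A s l :
  0 <= s -> L l -> A (x + s *: l) -> (dir_min_time L x A <= s%:E)%E.
Proof.
move=> s0 Ll Asl; apply: ereal_inf_lbound; exists s => //; split => //.
by exists (x + s *: l); split => //; exists l.
Qed.

Lemma dir_min_time_lt L x A t : (dir_min_time L x A < t%:E)%E ->
  exists s l, [/\ 0 <= s, s < t, L l & A (x + s *: l)].
Proof.
move=> /ereal_inf_lt[_ [s [s0 [_ [[l Ll <-] Asl]]] <-]].
by rewrite lte_fin => st; exists s, l.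
Qed.

Lemma dir_min_time_subset L x A B :
  A `<=` B -> (dir_min_time L x B <= dir_min_time L x A)%E.
Proof.
move=> AB; apply: le_ereal_inf_tmp => _ [s [s0 [_ [[l Ll <-] Asl]]] <-].
by apply: (dir_min_time_le _ _ _ _ _ s0 Ll); exact: AB.
Qed.

End DirMinTime.

Section Equivalences.
Context {R : realType} {X : normedModType R}.
Context (F : X -> set X) (L U : set X) (tau : R) (tau_gt0 : 0 < tau).

Lemma dir_orbitally_regular_Aubin :
  dir_orbitally_regular F U L tau ->
  dir_orbitally_Aubin (inverse_map F) U L tau.
Proof.
move=> regF x u Ux Fxu Td.
(* This inequality serves twice: it turns [Td] into the distance condition of regularity, and it
   weakens the bound that regularity returns. *)
have TFu : (tau%:E * dir_min_time L x (F x) <=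
            tau%:E * dir_min_time L x [set u])%E.
  rewrite lee_pmul2l // ?lte_fin //.
  by apply: dir_min_time_subset => _ ->.
exact: le_trans (regF x Ux (le_lt_trans TFu Td)) TFu.
Qed.

Lemma dir_orbitally_Aubin_open : L `<=` unit_sphere ->
  dir_orbitally_Aubin (inverse_map F) U L tau ->
  dir_orbitally_open F U L tau^-1.
Proof.
move=> LS AubF x t Ux /dir_min_time_lt[s [l [s0 st Ll Fxsl]]] td.
have {}st : tau * s < t by rewrite -ltr_pdivlMl.
have Ts : (tau%:E * dir_min_time L x [set x + s *: l]%R <= (tau * s)%:E)%E.
  rewrite EFinM lee_pmul2l ?lte_fin //.
  exact: (dir_min_time_le _ _ _ _ _ s0 Ll).
have Tst : (tau%:E * dir_min_time L x [set x + s *: l]%R < t%:E)%E.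
  by rewrite (le_lt_trans Ts)// lte_fin.
(* [Tst] and [td] give the distance condition of Aubin continuity at [u = x + s *: l]. The
   strictness of [Tst] then yields [r < t], as the open ball demands. *)
have /dir_min_time_lt[r [k [r0 rt Lk Frk]]] :=
  le_lt_trans (AubF x _ Ux Fxsl (lt_trans Tst td)) Tst.
exists (x + r *: k) => //; split; last first.
  by exists (r *: k) => //; exists r, k.
have k1 : `|k| = 1 := LS _ Lk.
by rewrite -ball_normE /ball_ /= opprD addNKr normrN normrZ k1 mulr1 ger0_norm.
Qed.

Lemma dir_orbitally_open_regular : L `<=` unit_sphere ->
  dir_orbitally_open F U L tau^-1 -> dir_orbitally_regular F U L tau.
Proof.
move=> LS openF x Ux; have := openF x ^~ Ux.
have := dir_min_time_ge0 L x (F x).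
(* The value [+oo] makes the distance hypothesis false because [tau > 0], and nonnegativity excludes
   [-oo]. *)
case: (dir_min_time L x (F x)) => [a _ openx| _ _|//]; last first.
  by rewrite gt0_muley ?lte_fin // ltNge leey.
rewrite -EFinM => ad; rewrite leNgt; apply/negP => aT.
(* The limit in [t] is replaced by a contradiction: a single [t] below both members of the minimum
   is admissible for openness, and the point so obtained lies in [F^{-1}(x)] and is reached from [x]
   at a time [s < t], so [t] cannot be below [T_L(x, F^{-1}(x))]. *)
have [t at_ ] := @lte_fin_between _ (tau * a)
  (Order.min (dist_to x (~` U)) (dir_min_time L x (inverse_map F x)))
  ltac:(by rewrite lt_min ad).
rewrite lt_min => /andP[td]; apply/negP; rewrite -leNgt.
have [|z [+ [_ [s [l [s0 Ll ->]]] zE]]] := openx t _ td.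
  by rewrite lte_fin ltr_pdivlMl.
rewrite -{z}zE => xzt Fx.
apply: le_trans (dir_min_time_le _ _ _ _ _ s0 Ll Fx) _; rewrite lee_fin ltW //.
have l1 : `|l| = 1 := LS _ Ll.
move: xzt; rewrite -ball_normE /ball_ /= opprD addNKr normrN normrZ l1 mulr1.
by rewrite ger0_norm.
Qed.

End Equivalences.

Theorem proposition2p8 (R : realType) (X : normedModType R) (F : X -> set X)
    (L U : set X) (tau : R)
    (L_sphere : L `<=` unit_sphere) (L_nonempty : L !=set0)
    (U_nonempty : U !=set0) (tau_gt0 : 0 < tau) :
  (dir_orbitally_regular F U L tau <->
     dir_orbitally_Aubin (inverse_map F) U L tau) /\
  (dir_orbitally_Aubin (inverse_map F) U L tau <->
     dir_orbitally_open F U L tau^-1).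
Proof.
have regular_Aubin := @dir_orbitally_regular_Aubin _ _ F L U _ tau_gt0.
have Aubin_open := @dir_orbitally_Aubin_open _ _ F L U _ tau_gt0 L_sphere.
have open_regular := @dir_orbitally_open_regular _ _ F L U _ tau_gt0 L_sphere.
split; split.
- exact: regular_Aubin.
- by move=> /Aubin_open/open_regular.
- exact: Aubin_open.
- by move=> /open_regular/regular_Aubin.
Qed.
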